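(* Let $\gamma\in\,]0,1[$, $\delta=2-\gamma$, and let $(\lambda_n)_{n\ge 0}$ be a sequence in $]0,\delta[$ such that $\sum_{n}\lambda_n(\delta-\lambda_n)=+\infty$. Let $\mathbf{x}_0\in\mathbf{X}$ and, for $n=0,1,\dots$, set $$\mathbf{y}_n=(1-\gamma)\mathbf{x}_n+\gamma\mathbf{R}\mathbf{x}_n,\qquad \mathbf{x}_{n+1}=\mathbf{x}_n+\lambda_n(\operatorname{Prox}_{\gamma\mathbf{g}}\mathbf{y}_n-\mathbf{x}_n),$$ where $\mathbf{g}=\operatorname{cl}(\mathbf{f}\Box\iota_\Delta)$. Then: (i) $(\mathbf{x}_n)$ converges weakly to some $\tilde{\mathbf{x}}$ which is a generalized cycle of $\mathbf{g}$, i.e., a solution of $0\in\partial\mathbf{g}(\tilde{\mathbf{x}})+(\operatorname{Id}-\mathbf{R})\tilde{\mathbf{x}}$. (ii) $(\mathbf{R}\mathbf{x}_n-\mathbf{x}_n)$ converges strongly to $\mathbf{y}=\mathbf{R}\tilde{\mathbf{x}}-\tilde{\mathbf{x}}$, the unique generalized gap vector of $\mathbf{g}$, i.e., the unique solution of $0\in\partial(\mathbf{f}^*+\iota_\Delta^* )(\mathbf{y})+\frac12\mathbf{y}+T\mathbf{y}$. (iii) $(P_{\Delta^\perp}\mathbf{x}_n)$ converges strongly to $P_{\Delta^\perp}\tilde{\mathbf{x}}=\mathbf{x}$, the unique solution of: $0\in\partial\mathbf{g}(\mathbf{x})+(\operatorname{Id}-\mathbf{R})\mathbf{x}$ and $\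mathbf{x}\in\Delta^\perp$.
   Context: $X$ is a real Hilbert space, $m\in\{1,2,\dots\}$, $\mathbf{X}=X^m$ is the product Hilbert space, $\mathbf{R}(x_1,\dots,x_m)=(x_m,x_1,\dots,x_{m-1})$, $\Delta=\{(x,\dots,x):x\in X\}$ with orthogonal complement $\Delta^\perp$, $P_{\Delta^\perp}$ is the orthogonal projection onto $\Delta^\perp$, and $T=\frac{1}{2m}\sum_{k=1}^{m-1}(m-2k)\mathbf{R}^k$. $f_1,\dots,f_m$ are proper lower semicontinuous convex functions $X\to\,]-\infty,+\infty]$, $\mathbf{f}(x_1,\dots,x_m)=\sum_{i=1}^m f_i(x_i)$, $\mathbf{f}^*$ is the Fenchel conjugate, $\iota_\Delta$ the indicator function of $\Delta$ (so $\iota_\Delta^*=\iota_{\Delta^\perp}$), $(\mathbf{f}\Box\iota_\Delta)(\mathbf{x})=\inf_{\mathbf{u}\in\mathbf{X}}(\mathbf{f}(\mathbf{u})+\iota_\Delta(\mathbf{x}-\mathbf{u}))$, $\operatorname{cl}$ is the lower semicontinuous hull, $\partial$ the convex subdifferential, and $\operatorname{Prox}_{\gamma\mathbf{g}}=(\operatorname{Id}+\gamma\,\partial\mathbf{g})^{-1}$. Standing assumption: $\operatorname{dom}\mathbf{f}^*\cap\Delta^\perp\neq\varnothing$. *)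

(* Defs.v *)
From HB Require Import structures.
From mathcomp Require Import all_boot all_order all_algebra.
From mathcomp Require Import all_classical all_reals all_analysis.
From mathcomp Require Import ring lra.

Set Implicit Arguments.
Unset Strict Implicit.
Unset Printing Implicit Defensive.

Import Order.TTheory GRing.Theory Num.Theory.
Import numFieldNormedType.Exports.

Local Open Scope classical_set_scope.
Local Open Scope ring_scope.

HB.mixin Record CompleteNormedModule_isHilbert (R : realType) E
    & CompleteNormedModule R E := {
  inner : {dot E for (@idfun R)};
  normE_inner : forall x : E, `|x| = Num.sqrt (inner x x)
}.

#[short(type="hilbertType")]
HB.structure Definition Hilbert (R : realType) :=
  {E of CompleteNormedModule R E & CompleteNormedModule_isHilbert R E}.

Section real_inner_product.
Context (R : realType) (E : lmodType R) (ip : {dot E for (@idfun R)}).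

Let ipC x y : ip x y = ip y x.
Proof.
by rewrite (@hermitian_subproof _ _ _ _ ip x y) expr0 mul1r.
Qed.

Let ip_ge0 x : 0 <= ip x x.
Proof.
have [->|x0] := eqVneq x 0; first by rewrite linear0r.
exact/ltW/neq0_dnorm_gt0.
Qed.

Let ipDl x y z : ip (x + y) z = ip x z + ip y z.
Proof. exact: linearDl. Qed.

Let ipZl (t : R) x z : ip (t *: x) z = t * ip x z.
Proof. exact: linearZl_LR. Qed.

Let ipDZ (t : R) x y :
  ip (x + t *: y) (x + t *: y) = ip x x + 2 * t * ip x y + t ^+ 2 * ip y y.
Proof.
rewrite ipDl ipZl (ipC x) (ipC y) !ipDl !ipZl (ipC y x).
by ring.
Qed.

Let cauchy_schwarz x y : ip x y <= Num.sqrt (ip x x) * Num.sqrt (ip y y).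
Proof.
have [->|y0] := eqVneq y 0.
  by rewrite linear0r mulr_ge0 ?sqrtr_ge0.
have yy : 0 < ip y y by exact: neq0_dnorm_gt0.
have := ip_ge0 (x + (- ip x y / ip y y) *: y); rewrite ipDZ.
have -> : ip x x + 2 * (- ip x y / ip y y) * ip x y +
    (- ip x y / ip y y) ^+ 2 * ip y y = ip x x - ip x y ^+ 2 / ip y y.
  by field; rewrite gt_eqF.
rewrite subr_ge0 ler_pdivrMr// => h.
rewrite -sqrtrM; last exact: ip_ge0.
by apply: le_trans (ler_wsqrtr h); rewrite sqrtr_sqr ler_norm.
Qed.

Lemma inner_triangle x y :
  Num.sqrt (ip (x + y) (x + y)) <= Num.sqrt (ip x x) + Num.sqrt (ip y y).
Proof.
have s0 : 0 <= Num.sqrt (ip x x) + Num.sqrt (ip y y).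
  by rewrite addr_ge0// sqrtr_ge0.
rewrite -(ger0_norm s0) -sqrtr_sqr ler_wsqrtr// sqrrD !sqr_sqrtr//.
have := ipDZ 1 x y; rewrite scale1r => ->.
rewrite expr1n mul1r mulr1 lerD2r lerD2l mulr_natl ler_pMn2r//.
Qed.

Lemma inner_normZ (t : R) x :
  Num.sqrt (ip (t *: x) (t *: x)) = `|t| * Num.sqrt (ip x x).
Proof.
by rewrite ipZl ipC ipZl mulrA -expr2 sqrtrM ?sqr_ge0// sqrtr_sqr.
Qed.

Lemma inner_norm_eq0 x : Num.sqrt (ip x x) = 0 -> x = 0.
Proof.
move/eqP; rewrite sqrtr_eq0 => h; apply/eqP; apply: contraTT h => x0.
by rewrite -ltNge neq0_dnorm_gt0.
Qed.

End real_inner_product.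

(* The m-fold product of X with inner product \sum_i inner (x i) (y i) and the
   norm and topology it induces. *)
Definition hilbert_pow (R : realType) (m : nat) (X : hilbertType R) : Type :=
  {ffun 'I_m -> X}.

Section hilbert_pow.
Context (R : realType) (m : nat) (X : hilbertType R).
Local Notation XX := (hilbert_pow m X).

HB.instance Definition _ := GRing.Lmodule.copy XX {ffun 'I_m -> X}.

Definition inner_pow (x y : XX) : R :=
  \sum_(i < m) inner (x i : X) (y i).

Let inner_powC x y : inner_pow x y = inner_pow y x.
Proof.
by apply: eq_bigr => i _; rewrite (@hermitian_subproof _ _ _ _ inner) expr0 mul1r.
Qed.

Let inner_powBl y : zmod_morphism (inner_pow ^~ y).
Proof.
move=> x x'; rewrite /inner_pow -sumrB; apply: eq_bigr => i _.
by rewrite !ffunE linearBl.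
Qed.

Let inner_powZl y : scalable_for *%R (inner_pow ^~ y).
Proof.
move=> t x; rewrite /inner_pow mulr_sumr; apply: eq_bigr => i _.
by rewrite !ffunE linearZl_LR.
Qed.

Let inner_powBr x : zmod_morphism (inner_pow x).
Proof. by move=> y y'; rewrite !(inner_powC x) inner_powBl. Qed.

Let inner_powZr x : scalable_for (idfun \; *%R) (inner_pow x).
Proof. by move=> t y; rewrite !(inner_powC x) inner_powZl. Qed.

Let inner_pow_hermitian x y :
  inner_pow x y = (-1) ^+ false * idfun (inner_pow y x).
Proof. by rewrite expr0 mul1r inner_powC. Qed.

Let inner_ge0 (x : X) : 0 <= inner x x.
Proof.
have [->|x0] := eqVneq x 0; first by rewrite linear0r.
exact/ltW/neq0_dnorm_gt0.
Qed.

Let inner_pow_gt0 x : x != 0 -> 0 < inner_pow x x.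
Proof.
move=> x0; rewrite lt0r sumr_ge0 ?andbT; last by move=> i _; exact: inner_ge0.
apply: contra_neq x0 => /eqP; rewrite psumr_eq0; last first.
  by move=> i _; exact: inner_ge0.
move=> /allP h; apply/ffunP => i; rewrite ffunE.
have /eqP xi0 := h i (mem_index_enum _).
apply: contra_eq xi0 => xi; exact/lt0r_neq0/neq0_dnorm_gt0.
Qed.

HB.instance Definition _ := @isBilinear.Build R XX XX R *%R (idfun \; *%R)
  inner_pow inner_powBl inner_powBr inner_powZl inner_powZr.
HB.instance Definition _ := @isHermitianSesquilinear.Build R XX false idfun
  inner_pow inner_pow_hermitian.
HB.instance Definition _ := @isDotProduct.Build R XX inner_pow inner_pow_gt0.

Let dot_pow : {dot XX for (@idfun R)} := inner_pow.

HB.instance Definition _ := @Lmodule_isNormed.Build R XX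
  (fun x => Num.sqrt (inner_pow x x)) (inner_triangle dot_pow)
  (inner_normZ dot_pow) (@inner_norm_eq0 _ _ dot_pow).

Let norm_powE (x : XX) : `|x| = Num.sqrt (inner_pow x x).
Proof. by []. Qed.

Let norm_pow_ge (x : XX) i : `|x i : X| <= `|x|.
Proof.
rewrite norm_powE normE_inner ler_wsqrtr// /inner_pow (bigD1 i)//= lerDl.
by apply: sumr_ge0 => j _; exact: inner_ge0.
Qed.

Let norm_pow_le (x : XX) : `|x| <= \sum_(i < m) `|x i : X|.
Proof.
have s0 : 0 <= \sum_(i < m) `|x i : X| by exact: sumr_ge0.
rewrite norm_powE -(ger0_norm s0) -sqrtr_sqr ler_wsqrtr//.
rewrite expr2 mulr_suml; apply: ler_sum => i _.
have -> : inner (x i : X) (x i) = `|x i : X| * `|x i : X|.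
  by rewrite normE_inner -expr2 sqr_sqrtr.
rewrite ler_wpM2l// (bigD1 i)//= lerDl.
exact: sumr_ge0.
Qed.

Let pow_complete (F : set_system XX) : ProperFilter F -> cauchy F -> cvg F.
Proof.
move=> FF /cauchyP Fc.
have Fi i : cvg ((fun x : XX => x i : X) @ F).
  apply: cauchy_cvg; apply: cauchy_exP => e e0.
  have [x Fx] := Fc _ e0; exists (x i).
  suff : F [set y : XX | ball (x i : X) e (y i : X)] by [].
  apply: filterS Fx => y; rewrite /= -!ball_normE /=.
  apply: le_lt_trans; have := norm_pow_ge (x - y) i.
  by rewrite !ffunE.
apply/cvg_ex; exists ([ffun i => lim ((fun x : XX => x i : X) @ F)] : XX).
apply/cvgrPdist_lt => e e0.
have d0 : 0 < e / m.+1%:R by rewrite divr_gt0.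
near=> x.
apply: (le_lt_trans (norm_pow_le _)).
apply: (@le_lt_trans _ _ (\sum_(i < m) e / m.+1%:R)).
  apply: ler_sum => i _; rewrite !ffunE; apply/ltW; move: i.
  near: x; apply: filter_forall => i.
  by move/cvgrPdist_lt: (Fi i) => /(_ _ d0).
rewrite sumr_const card_ord -mulrnAr -[X in _ < X]mulr1 ltr_pM2l//.
by rewrite -mulr_natr mulrC ltr_pdivrMr// mul1r ltr_nat.
Unshelve. all: by end_near. Qed.

HB.instance Definition _ := Uniform_isComplete.Build XX pow_complete.
HB.instance Definition _ :=
  CompleteNormedModule_isHilbert.Build R XX norm_powE.

Lemma inner_powE (x y : XX) : inner x y = \sum_(i < m) inner (x i : X) (y i).
Proof. by []. Qed.

End hilbert_pow.

Section convex_analysis.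
Context (R : realType) (E : hilbertType R).
Implicit Types (f h : E -> \bar R) (C V : set E) (x y u p : E).

Definition dom f : set E := [set x | (f x < +oo)%E].

Definition proper_fun f := (forall x, (-oo < f x)%E) /\ dom f !=set0.

(* Only meant for functions that never take the value -oo, so that the
   right-hand side contains no indeterminate sum. *)
Definition convex_efun f := forall x y (t : R), 0 < t < 1 ->
  (f (t *: x + (1 - t) *: y)%R <= t%:E * f x + (1 - t)%:E * f y)%E.

Definition proper_lsc_convex f :=
  [/\ proper_fun f, lower_semicontinuous f & convex_efun f].

Definition indicator C : E -> \bar R :=
  fun x => if `[< C x >] then 0%E else +oo%E.

Definition conjugate f : E -> \bar R :=
  fun u => ereal_sup [set ((inner x u)%:E - f x)%E | x in [set: E]].

Definition infconv f h : E -> \bar R :=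
  fun x => ereal_inf [set (f u + h (x - u)%R)%E | u in [set: E]].

(* The largest lower semicontinuous function majorized by f. *)
Definition lsc_hull f : E -> \bar R :=
  fun x => ereal_sup
    [set h x | h in [set h | lower_semicontinuous h /\
                             forall z, (h z <= f z)%E]].

Definition subdiff f x : set E :=
  [set u | forall y, ((inner (y - x)%R u)%:E + f x <= f y)%E].

(* A selection of the set-valued inverse (Id + gamma * subdiff f)^-1, which is
   single-valued with full domain when gamma > 0 and f is proper, lsc
   and convex. The default value 0 is taken where the inverse is empty. *)
Definition prox (gamma : R) f y : E :=
  xget 0 [set p | [set p + gamma *: u | u in subdiff f p] y].

Definition orthocomp V : set E := [set x | forall v, V v -> inner x v = 0].

(* The point p of V with x - p orthogonal to V, which exists and is unique when
   V is a closed subspace. *)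
Definition orthoproj V x : E := xget 0 [set p | V p /\ orthocomp V (x - p)].

Definition weakly_cvg (x_ : nat -> E) x :=
  forall u, inner (x_ n) u @[n --> \oo] --> inner x u.

End convex_analysis.

Section cycles.
Context (R : realType) (m : nat) (X : hilbertType R).
Local Notation XX := (hilbert_pow m X).
Implicit Types (f : 'I_m -> X -> \bar R) (g : XX -> \bar R) (x y : XX).

(* ord_pred is the cyclic predecessor on 'I_m: the first component of
   cshift x is the last component of x. *)
Definition cshift x : XX := [ffun i => x (ord_pred i)].

Definition Delta : set XX := [set ([ffun=> z] : XX) | z in [set: X]].

Definition skewT x : XX :=
  (2 * m%:R)^-1 *: \sum_(1 <= k < m) (m%:R - 2 * k%:R) *: iter k cshift x.

Definition sepsum f : XX -> \bar R := fun x => (\sum_(i < m) f i (x i))%E.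

Definition generalized_cycle g : set XX :=
  [set x | [set u + (x - cshift x) | u in subdiff g x] 0].

Definition generalized_gap_vector f : set XX :=
  [set y | [set u + 2^-1 *: y + skewT y |
            u in subdiff (fun z => conjugate (sepsum f) z +
                                   conjugate (indicator Delta) z)%E y] 0].

End cycles.

Arguments Delta {R} m X.

(* Main.v *)
Require Import Defs.
From HB Require Import structures.
From mathcomp Require Import all_boot all_order all_algebra.
From mathcomp Require Import all_classical all_reals all_analysis.
From mathcomp Require Import ring lra.

Set Implicit Arguments.
Unset Strict Implicit.
Unset Printing Implicit Defensive.

Import Order.TTheory GRing.Theory Num.Theory.
Import numFieldNormedType.Exports.

Local Open Scope classical_set_scope.
Local Open Scope ring_scope.

(** Write R for the cyclic shift, D for the diagonal and P for the projection
    onto its orthogonal complement. The fixed points of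
    S = Prox_(gamma g) o ((1 - gamma) Id + gamma R) are the generalized cycles
    of g, and weak convergence turns out to be strong: the component of the
    iterates along D never moves, while S is a strict contraction across D.

    The function g is invariant under translations by D, so its subgradients
    are orthogonal to D ([subdiff_hull_orthocomp]); hence S z - S z' is
    orthogonal to D whenever z - z' is. On the orthogonal complement of D the
    operator 1/2 Id + T is a bounded left inverse of Id - R
    ([skewT_left_inverse]), so that |z - R z| >= |z| / K there. A convex
    combination of two vectors of equal norm is shorter than they are, by an
    amount governed by their distance; hence (1 - gamma) Id + gamma R contracts
    the complement of D by a factor q < 1, and so does S, the proximal map being
    nonexpansive ([fb_step_contraction]). Banach's fixed point theorem gives the
    only generalized cycle u that is orthogonal to D.

    The candidate limit is u + (x 0 - P (x 0)), again a generalized cycle by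
    translation invariance. The differences d n = x n - (u + (x 0 - P (x 0)))
    remain orthogonal to D. Since S is averaged with constant 1 / (2 - gamma),
    relaxation by a factor lambda decreases |d n|^2 by at least
    lambda (2 - gamma - lambda) |d n - s|^2, where s is the image of d n under
    the step ([relaxed_step_le]); as |s| <= q |d n|, this is at least
    lambda (2 - gamma - lambda) (1 - q)^2 |d n|^2, and the divergence of the
    series of the lambda (2 - gamma - lambda) forces d n to 0
    ([cvg0_of_divergent_decrease]).

    For the gap vectors, Fenchel duality carries a subgradient of g at u to a
    subgradient of f^* + iota_D^* with the roles of the two vectors exchanged
    ([subdiff_conjugate_sum]). Applied to R u - u at u, this says that R u - u
    is a gap vector, because (1/2 Id + T)(u - R u) = u; there is no other, since
    1/2 Id + T is strongly monotone, T being skew.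

    The resolvent of the subdifferential of g exists everywhere by direct
    minimization ([resolvent_exists]): a minimizing sequence is Cauchy by
    strong convexity of the squared norm. The minimization runs over the values
    of the infimal convolution itself, which are within reach of the convexity
    of f, and the resulting affine minorant passes to its hull g. *)

(** * Inner products *)

Section hilbert_geometry.
Context (R : realType) (E : hilbertType R).
Implicit Types (x y z u v : E) (t : R).

Lemma innerC x y : inner x y = inner y x.
Proof. by rewrite (@hermitian_subproof _ _ _ _ inner) expr0 mul1r. Qed.

Lemma innerDl x y z : inner (x + y) z = inner x z + inner y z.
Proof. exact: linearDl. Qed.

Lemma innerNl x z : inner (- x) z = - inner x z.
Proof. exact: linearNl. Qed.

Lemma innerZl t x z : inner (t *: x) z = t * inner x z.
Proof. exact: linearZl_LR. Qed.

Lemma inner0l x : inner 0 x = 0.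
Proof. exact: linear0l. Qed.

Lemma innerDr x y z : inner z (x + y) = inner z x + inner z y.
Proof. exact: linearDr. Qed.

Lemma innerNr x z : inner z (- x) = - inner z x.
Proof. exact: linearNr. Qed.

Lemma innerZr t x z : inner z (t *: x) = t * inner z x.
Proof. exact: linearZr_LR. Qed.

Definition innerE := (innerDl, innerNl, innerZl, innerDr, innerNr, innerZr).

Lemma inner_suml (I : Type) (r : seq I) (P : pred I) (F : I -> E) z :
  inner (\sum_(i <- r | P i) F i) z = \sum_(i <- r | P i) inner (F i) z.
Proof.
by apply: (big_morph (inner^~ z)) => [x y|]; rewrite ?innerDl ?inner0l.
Qed.

Lemma inner_ge0 x : 0 <= inner x x.
Proof.
have [->|x0] := eqVneq x 0; first by rewrite inner0l.
exact/ltW/neq0_dnorm_gt0.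
Qed.

Lemma inner_self x : inner x x = `|x| ^+ 2.
Proof. by rewrite normE_inner sqr_sqrtr ?inner_ge0. Qed.

Lemma inner_eq0 x : inner x x <= 0 -> x = 0.
Proof.
rewrite inner_self => h; apply/eqP; rewrite -normr_eq0 -sqrf_eq0.
by rewrite eq_le h sqr_ge0.
Qed.

(** Together with [innerE] and [ring] or [field], this turns an identity between
    linear combinations of vectors into a scalar computation. *)
Lemma inner_ext x y : (forall z, inner x z = inner y z) -> x = y.
Proof.
move=> h; apply/eqP; rewrite -subr_eq0; apply/eqP/inner_eq0.
by rewrite innerDl innerNl h subrr.
Qed.

Lemma sqr_normD x y : `|x + y| ^+ 2 = `|x| ^+ 2 + 2 * inner x y + `|y| ^+ 2.
Proof. by rewrite -!inner_self !innerE (innerC y x); ring. Qed.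

Lemma inner_le_norm x y : inner x y <= `|x| * `|y|.
Proof.
have h : `|x + y| ^+ 2 <= (`|x| + `|y|) ^+ 2.
  by rewrite ler_sqr ?nnegrE ?addr_ge0// ler_normD.
by move: h; rewrite sqr_normD sqrrD; lra.
Qed.

Lemma norm_inner_le x y : `|inner x y| <= `|x| * `|y|.
Proof.
rewrite ler_norml inner_le_norm andbT lerNl -innerNl.
by rewrite (le_trans (inner_le_norm _ _))// normrN.
Qed.

Lemma inner_cvgl (T : Type) (F : set_system T) {FF : Filter F}
    (h : T -> E) x u :
  h z @[z --> F] --> x -> inner (h z) u @[z --> F] --> inner x u.
Proof.
move=> /cvgrPdist_lt hx; apply/cvgrPdist_lt => e e0.
have d0 : 0 < e / (`|u| + 1) by rewrite divr_gt0// ltr_wpDl.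
apply: filterS (hx _ d0) => z; rewrite ltr_pdivlMr ?ltr_wpDl// => hz.
rewrite -innerNl -innerDl (le_lt_trans (norm_inner_le _ _))//.
by rewrite (le_lt_trans _ hz)// ler_wpM2l// lerDl.
Qed.

(** The midpoint of two nearly optimal points is optimal up to the defect of
    strong convexity of the squared norm, which bounds their distance. *)
Lemma sqr_norm_midpoint x y z :
  `|2^-1 *: x + (1 - 2^-1) *: y - z| ^+ 2 =
  2^-1 * `|x - z| ^+ 2 + 2^-1 * `|y - z| ^+ 2 - 4^-1 * `|x - y| ^+ 2.
Proof.
by rewrite -!inner_self !innerE (innerC y x) (innerC z x) (innerC z y); field.
Qed.

End hilbert_geometry.

(** * Resolvents by direct minimization *)

Section resolvent.
Context (R : realType) (E : hilbertType R).
Implicit Types (x y z w p : E) (t r : R).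

Lemma ge0_of_small_slope (a b : R) :
  (forall t, 0 < t < 1 -> 0 <= a + t * b) -> 0 <= a.
Proof.
move=> h; rewrite leNgt; apply/negP => a0.
have b0 : 0 <= `|b| by [].
have d0 : 0 < `|b| - a by lra.
have d1 : 0 < `|b| - a + 1 by lra.
(* This value of t keeps t |b| below - a. *)
have /h : 0 < - a / (`|b| - a + 1) / 2 < 1.
  rewrite divr_gt0 ?divr_gt0//= ?oppr_gt0//.
  by rewrite ltr_pdivrMr// ltr_pdivrMr//; lra.
suff : - a / (`|b| - a + 1) / 2 * b < - a by lra.
have hb : b <= `|b| by exact: ler_norm.
rewrite mulrAC ltr_pdivrMr// mulrAC ltr_pdivrMr//.
have : (-a) * b <= (-a) * `|b| by rewrite ler_wpM2l// oppr_ge0 ltW.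
have : 0 < (-a) * (-a + 1) by rewrite mulr_gt0//; lra.
have : 0 <= (-a) * `|b| by rewrite mulr_ge0//; lra.
lra.
Qed.

(** The set [C] plays the part of an epigraph, and [w], [b] of an affine
    minorant. Minimizing r + |x - y|^2 / (2 gamma) over [C] produces [p] as the
    limit of the x components and [rho] as the limit of the r components of a
    minimizing sequence. Comparing the infimum with its values along segments
    towards a point of [C] shows that the affine function through (p, rho) of
    slope (y - p) / gamma lies below [C]. As [C] is not assumed closed, (p, rho)
    is only known to be adherent to it. *)
Lemma resolvent_exists (C : E -> R -> Prop) (w : E) (b gamma : R) (y : E) :
  0 < gamma ->
  (forall x r x' r' t, 0 < t < 1 -> C x r -> C x' r' ->
     C (t *: x + (1 - t) *: x') (t * r + (1 - t) * r')) ->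
  (exists x r, C x r) ->
  (forall x r, C x r -> inner x w + b <= r) ->
  exists p rho,
    (forall e, 0 < e -> exists x r, [/\ C x r, `|p - x| < e & r < rho + e]) /\
    (forall z r, C z r -> rho + inner (z - p) (gamma^-1 *: (y - p)) <= r).
Proof.
move=> g0 cvxC [x0 [r0 C0]] minC.
pose k := (2 * gamma)^-1; have k0 : 0 < k by rewrite invr_gt0 mulr_gt0.
pose phi x r := r + k * `|x - y| ^+ 2.
pose S := [set s | exists x r, C x r /\ s = phi x r].
have S0 : S !=set0 by exists (phi x0 r0), x0, r0.
have lbS : has_lbound S.
  (* Completing the square in the affine minorant plus k |x - y|^2. *)
  exists (inner y w + b - (4 * k)^-1 * `|w| ^+ 2) => _ [x [r [Cxr ->]]].
  rewrite /phi; have h1 := minC _ _ Cxr.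
  have h2 : - (`|x - y| * `|w|) <= inner (x - y) w.
    by rewrite lerNl -innerNr (le_trans (inner_le_norm _ _))// normrN.
  have h3 : 0 <= k * (`|x - y| - (2 * k)^-1 * `|w|) ^+ 2.
    by rewrite mulr_ge0 ?sqr_ge0// ltW.
  have h4 : k * (`|x - y| - (2 * k)^-1 * `|w|) ^+ 2 =
      k * `|x - y| ^+ 2 - `|x - y| * `|w| + (4 * k)^-1 * `|w| ^+ 2.
    by field; rewrite gt_eqF.
  have h5 : inner (x - y) w = inner x w - inner y w by rewrite !innerE.
  lra.
pose I := inf S.
have I_le x r : C x r -> I <= phi x r.
  by move=> Cxr; apply: ge_inf => //; exists x, r.
have /choice[u uP] : forall n : nat, exists u : E * R,
    C u.1 u.2 /\ phi u.1 u.2 < I + n.+1%:R^-1.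
  move=> n; have hI : has_inf S by split.
  have [|_ [x [r [Cxr ->]]] hx] := @inf_adherent _ S n.+1%:R^-1 _ hI.
    by rewrite invr_gt0.
  by exists (x, r).
(* The infimum also bounds the value at the midpoint from below. *)
have dist n m : `|(u n).1 - (u m).1| ^+ 2 <=
    2 / k * (n.+1%:R^-1 + m.+1%:R^-1).
  have [Cn hn] := uP n; have [Cm hm] := uP m.
  have half01 : 0 < (2^-1 : R) < 1 by lra.
  have := I_le _ _ (cvxC _ _ _ _ _ half01 Cn Cm).
  rewrite /phi sqr_norm_midpoint => h.
  rewrite mulrAC ler_pdivlMr//; move: hn hm h; rewrite /phi.
  move: (n.+1%:R^-1) (m.+1%:R^-1) (`|_|^+2) (`|_|^+2) (`|_|^+2) => a1 a2 a3 a4 a5.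
  by clearbody I k; lra.
have cu : cvgn (fun n => (u n).1).
  apply/cauchy_cvgP; apply/cauchy_ballP => e e0; near_simpl.
  have d0 : 0 < k * e ^+ 2 / 4 by rewrite divr_gt0 ?mulr_gt0 ?exprn_gt0.
  have [N _ hN] := near_infty_natSinv_lt (PosNum d0).
  exists ([set n | N <= n], [set n | N <= n])%N; first by split; exists N.
  move=> [n m] [/= /hN/= hn /hN/= hm]; rewrite -ball_normE /=.
  rewrite -ltr_sqr ?nnegrE ?(ltW e0)//.
  rewrite (le_lt_trans (dist _ _))// mulrAC ltr_pdivrMr//.
  move: hn hm; move: (n.+1%:R^-1) (m.+1%:R^-1) => a1 a2; lra.
pose p := limn (fun n => (u n).1).
have up : (u n).1 @[n --> \oo] --> p := cu.
pose rho := I - k * `|p - y| ^+ 2.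
have phiI : phi (u n).1 (u n).2 @[n --> \oo] --> I.
  apply/cvgrPdist_lt => e e0; near=> n.
  have [Cn hn] := uP n; have h1 := I_le _ _ Cn.
  have h2 : n.+1%:R^-1 < e by near: n; exact: (near_infty_natSinv_lt (PosNum e0)).
  rewrite ltr_norml; move: hn h1 h2.
  move: (n.+1%:R^-1) (phi _ _) => a1 a2.
  by clearbody I => ? ? ?; apply/andP; split; lra.
have sqcvg (h : nat -> E) l v : h n @[n --> \oo] --> l ->
    k * `|h n - v| ^+ 2 @[n --> \oo] --> k * `|l - v| ^+ 2.
  move=> hl; apply: cvgMr.
  have hv : `|h n - v| @[n --> \oo] --> `|l - v|.
    by apply: cvg_norm; apply: cvgB => //; exact: cvg_cst.
  exact: (cvgM hv hv).
have urho : (u n).2 @[n --> \oo] --> rho.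
  have -> : (fun n => (u n).2) =
      (fun n => phi (u n).1 (u n).2 - k * `|(u n).1 - y| ^+ 2).
    by apply/funext => n; rewrite /phi; ring.
  by apply: cvgB => //; exact: sqcvg.
exists p, rho; split.
  move=> e e0; near \oo => n; exists (u n).1, (u n).2; split.
  - by case: (uP n).
  - by near: n; move/cvgrPdist_lt: up; exact.
  - have : `|rho - (u n).2| < e by near: n; move/cvgrPdist_lt: urho; exact.
    by rewrite ltr_norml => /andP[]; lra.
move=> z r Cz; rewrite -subr_ge0.
apply: (@ge0_of_small_slope _ (k * `|z - p| ^+ 2)) => t t01.
(* The value at the point dividing the segment from [u n] to [z], as n grows. *)
have key : I <= (1 - t) * rho + t * r + k * `|t *: z + (1 - t) *: p - y| ^+ 2.
  have shuffle v : t *: z + (1 - t) *: v - y = (1 - t) *: v - (y - t *: z).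
    by rewrite opprB [RHS]addrCA addrA.
  rewrite shuffle.
  have lim : (1 - t) * (u n).2 + t * r +
      k * `|(1 - t) *: (u n).1 - (y - t *: z)| ^+ 2 @[n --> \oo] -->
      (1 - t) * rho + t * r + k * `|(1 - t) *: p - (y - t *: z)| ^+ 2.
    apply: cvgD; last by apply: sqcvg; exact: cvgZr.
    by apply: cvgD; [exact: cvgMr|exact: cvg_cst].
  apply: (cvgr_to_ge lim); apply: nearW => n.
  have [Cn _] := uP n.
  have := I_le _ _ (cvxC _ _ _ _ _ t01 Cz Cn); rewrite /phi.
  by rewrite shuffle [t * r + _]addrC.
have t0 : 0 < t by case/andP: t01.
rewrite -(pmulr_rge0 _ t0).
move: key; rewrite /rho -!inner_self !innerE (innerC z p) (innerC y p) (innerC y z).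
rewrite -subr_ge0 => /le_trans; apply; rewrite le_eqVlt; apply/orP; left.
by apply/eqP; rewrite /k; field; rewrite gt_eqF.
Unshelve. all: by end_near. Qed.

End resolvent.

(** * Subdifferentials and lower semicontinuous hulls *)

Section subdifferential.
Context (R : realType) (E : hilbertType R).
Implicit Types (phi : E -> \bar R) (x y z u v w p : E).

(** If [phi x] were infinite, the subgradient inequality would make [phi]
    infinite everywhere. *)
Lemma subdiff_fin_num phi x u :
  proper_fun phi -> subdiff phi x u -> phi x \is a fin_num.
Proof.
move=> [phiN [z zfin]] xu; rewrite fin_numElt phiN/=.
rewrite ltey; apply/eqP => xy; have := xu z.
by rewrite xy addey// leye_eq => /eqP zy; move: zfin; rewrite /dom/= zy ltxx.
Qed.

Lemma subdiff_monotone phi x u y v :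
  proper_fun phi -> subdiff phi x u -> subdiff phi y v ->
  0 <= inner (x - y) (u - v).
Proof.
move=> pphi xu yv.
have := xu y; have := yv x.
rewrite -(fineK (subdiff_fin_num pphi xu)) -(fineK (subdiff_fin_num pphi yv)).
by rewrite -!EFinD !lee_fin !innerE; lra.
Qed.

Lemma prox_subdiff phi gamma y :
  0 < gamma -> (exists p, subdiff phi p (gamma^-1 *: (y - p))) ->
  subdiff phi (prox gamma phi y) (gamma^-1 *: (y - prox gamma phi y)).
Proof.
move=> g0 [p hp]; rewrite /prox.
set A := (X in xget 0 X).
have : A (xget 0 A).
  apply: xgetPex; exists p, (gamma^-1 *: (y - p)) => //.
  by rewrite scalerA divff ?gt_eqF// scale1r addrC subrK.
case=> u hu <-.
by rewrite [X in X - _]addrC addrK scalerA mulVf ?gt_eqF// scale1r.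
Qed.

Lemma affine_lsc w b : lower_semicontinuous (fun x => (inner x w + b)%:E).
Proof.
move=> x a; rewrite lte_fin => ax.
have : inner y w + b @[y --> x] --> inner x w + b.
  by apply: cvgD; [apply: inner_cvgl; exact: cvg_id|exact: cvg_cst].
move=> /cvgr_gt/(_ _ ax) h; exists [set y | a < inner y w + b] => //.
Qed.

Lemma lsc_hull_le phi x : (lsc_hull phi x <= phi x)%E.
Proof. by apply: ge_ereal_sup => _ [h [_ hphi] <-]. Qed.

Lemma lsc_hull_max phi h x :
  lower_semicontinuous h -> (forall z, (h z <= phi z)%E) ->
  (h x <= lsc_hull phi x)%E.
Proof. by move=> hlsc hphi; apply: ereal_sup_ubound; exists h. Qed.

Lemma lsc_hull_lsc phi : lower_semicontinuous (lsc_hull phi).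
Proof.
move=> x a /ereal_sup_gt[_ [h [hlsc hphi] <-]] /hlsc[V Vx Vh].
by exists V => // y /Vh/lt_le_trans; apply; exact: lsc_hull_max.
Qed.

(** The translate of the hull is again a lower semicontinuous minorant of
    [phi], hence lies below the hull; translating back gives equality. *)
Lemma lsc_hull_shift phi d x :
  (forall z, phi (z + d)%R = phi z) -> lsc_hull phi (x + d)%R = lsc_hull phi x.
Proof.
suff le c z : (forall z, phi (z + c)%R = phi z) ->
    (lsc_hull phi (z + c)%R <= lsc_hull phi z)%E.
  move=> phid; apply: le_anti; apply/andP; split; first exact: le.
  rewrite -[X in (lsc_hull phi X <= _)%E](addrK d); apply: le => y.
  by rewrite -[in RHS](subrK d y) phid.
move=> phic; apply: (@lsc_hull_max _ (fun y => lsc_hull phi (y + c))).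
  move=> y a /lsc_hull_lsc[V Vy Vh]; exists [set y | V (y + c)] => //.
    suff : (y' + c) @[y' --> y] --> y + c by exact.
    by apply: cvgD; [exact: cvg_id|exact: cvg_cst].
  by move=> y' /= /Vh.
by move=> y; rewrite -[leRHS]phic; exact: lsc_hull_le.
Qed.

(** Convexity is required of the strict epigraph of [F] only; the subgradient
    inequality passes to the hull because the affine minorant of [F] found by
    minimization is itself lower semicontinuous, while lower semicontinuity
    bounds the hull at [p] by the limit of the minimizing values. *)
Lemma lsc_hull_resolvent F w (b gamma : R) y :
  0 < gamma ->
  (forall x r x' r' (t : R), 0 < t < 1 ->
     (F x < r%:E)%E -> (F x' < r'%:E)%E ->
     (F (t *: x + (1 - t) *: x')%R < (t * r + (1 - t) * r')%:E)%E) ->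
  dom F !=set0 ->
  (forall x, ((inner x w + b)%:E <= F x)%E) ->
  exists p, subdiff (lsc_hull F) p (gamma^-1 *: (y - p)).
Proof.
move=> g0 cvxF [x0 x0F] minF.
have [p [rho [near_p above]]] : exists p rho,
    (forall e, 0 < e -> exists x r, 
      [/\ (F x < r%:E)%E, `|p - x| < e & r < rho + e]) /\
    (forall z r, (F z < r%:E)%E ->
      rho + inner (z - p) (gamma^-1 *: (y - p)) <= r).
  apply: (resolvent_exists (w := w) (b := b) y g0 cvxF).
    exists x0, (fine (F x0) + 1).
    have Ffin : F x0 \is a fin_num.
      by rewrite fin_numElt x0F andbT (lt_le_trans _ (minF x0))// ltNyr.
    by rewrite -[ltLHS](fineK Ffin) lte_fin ltrDl.
  move=> x r Fxr; rewrite -lee_fin; exact: (le_trans (minF x) (ltW Fxr)).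
exists p => z.
have le_rho : (lsc_hull F p <= rho%:E)%E.
  have step a : rho < a -> (lsc_hull F p <= a%:E)%E.
    move=> rhoa; rewrite leNgt; apply/negP => /lsc_hull_lsc[V].
    move=> /nbhs_ballP[e /= e0 eV] Va.
    have d0 : 0 < Num.min e (a - rho) by rewrite lt_min e0 subr_gt0.
    have [x [r [Fxr px rrho]]] := near_p _ d0.
    have /Va : V x.
      by apply: eV; rewrite -ball_normE /= (lt_le_trans px)// ge_min lexx.
    rewrite ltNge (le_trans (lsc_hull_le _ _))// (le_trans (ltW Fxr))// lee_fin.
    move: rrho; have : Num.min e (a - rho) <= a - rho by rewrite ge_min lexx orbT.
    by move: (Num.min _ _) => ?; lra.
  by apply/lee_addgt0Pr => e e0; rewrite -EFinD; apply: step; rewrite ltrDl.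
set v := gamma^-1 *: (y - p) in above *.
have affine_le z' : ((inner z' v + (rho - inner p v))%:E <= F z')%E.
  rewrite leNgt; apply/negP => Fz'.
  have Ffin : F z' \is a fin_num.
    rewrite fin_numElt (lt_le_trans _ (minF z')) ?ltNyr//=.
    exact: lt_trans Fz' (ltry _).
  move: Fz'; rewrite -(fineK Ffin) lte_fin => /midf_lt [h1 h2].
  have /above : (F z' <
      ((fine (F z') + (inner z' v + (rho - inner p v))) / 2)%:E)%E.
    by rewrite -(fineK Ffin) lte_fin.
  by rewrite innerDl innerNl; lra.
have := lsc_hull_max z (@affine_lsc v (rho - inner p v)) affine_le.
apply: le_trans; apply: (@le_trans _ _ ((inner (z - p) v)%:E + rho%:E)%E).
  exact: leeD2l.
by rewrite -EFinD lee_fin innerDl innerNl; lra.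
Qed.

End subdifferential.

(** * Conjugates and infimal convolution with a subspace *)

Section conjugation.
Context (R : realType) (E : hilbertType R).
Implicit Types (phi : E -> \bar R) (x y z u v w : E) (D : set E).

Lemma conjugate_gtNy phi z : proper_fun phi -> (-oo < conjugate phi z)%E.
Proof.
move=> [phiN [x xfin]]; apply: (@lt_le_trans _ _ ((inner x z)%:E - phi x)%E).
  have xf : phi x \is a fin_num by rewrite fin_numElt phiN.
  by rewrite -(fineK xf) -EFinB ltNyr.
by apply: ereal_sup_ubound; exists x.
Qed.

Lemma conjugate_minorant phi x z (b : R) :
  proper_fun phi -> conjugate phi z = b%:E -> ((inner x z - b)%:E <= phi x)%E.
Proof.
move=> [phiN _] zb; have := phiN x.
have : ((inner x z)%:E - phi x <= b%:E)%E.
  by rewrite -zb; apply: ereal_sup_ubound; exists x.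
case: (phi x) => [r| |]//; first by rewrite -EFinB !lee_fin; lra.
by rewrite leey.
Qed.

Lemma conjugate_indicator D :
  D 0 -> (forall (t : R) d, D d -> D (t *: d)) ->
  conjugate (indicator D) = indicator (orthocomp D).
Proof.
move=> D0 DZ; apply/funext => z; rewrite {2}/indicator.
case: asboolP => [zD|/existsNP[d /not_implyP[Dd zd]]].
  apply: le_anti; apply/andP; split.
    apply: ge_ereal_sup => _ [d _ <-]; rewrite /indicator.
    case: asboolP => Dd; last by rewrite addeNy leNye.
    by rewrite innerC zD// sube0.
  apply: ereal_sup_ubound; exists 0 => //.
  by rewrite /indicator inner0l asboolT// sube0.
apply: eq_infty => r; apply: ereal_sup_ubound.
(* The multiple of d at which the linear form z takes the value r. *)
exists ((r / inner z d) *: d) => //.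
rewrite /indicator asboolT; last exact: DZ.
by rewrite sube0 innerZl (innerC d) divfK//; exact/eqP.
Qed.

End conjugation.

(** The values of [g] come from minimizing [phi] along the translates of [D].
    The vector [w], a point where the conjugate is finite and which is constant
    on these translates as a linear form, provides the affine minorant that
    keeps [g] away from -oo. *)
Section infconv_subspace.
Context (R : realType) (E : hilbertType R).
Context (phi : E -> \bar R) (D : set E) (phi_proper : proper_fun phi)
  (phi_convex : forall x r x' r' (t : R), 0 < t < 1 ->
    (phi x < r%:E)%E -> (phi x' < r'%:E)%E ->
    (phi (t *: x + (1 - t) *: x')%R < (t * r + (1 - t) * r')%:E)%E)
  (D0 : D 0) (DP : forall (a : R) x y, D x -> D y -> D (a *: x + y))
  (w : E) (wD : orthocomp D w) (w_dom : dom (conjugate phi) w).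
Implicit Types (x y z u v : E).

Let F := infconv phi (indicator D).
Let g := lsc_hull F.

Let phiN x : (-oo < phi x)%E. Proof. by case: phi_proper. Qed.

Let DZ (t : R) d : D d -> D (t *: d).
Proof. by move=> Dd; rewrite -[t *: d]addr0; exact: DP. Qed.

Let DD x y : D x -> D y -> D (x + y).
Proof. by move=> Dx Dy; rewrite -[x]scale1r; exact: DP. Qed.

Lemma infconv_ltP x (r : R) :
  (F x < r%:E)%E <-> exists2 u, D (x - u) & (phi u < r%:E)%E.
Proof.
split=> [/ereal_inf_ltP[_ [u _ <-]]|[u Du ur]].
  rewrite /indicator; case: asboolP => Du; first by rewrite adde0; exists u.
  by rewrite addey// gt_eqF.
apply/ereal_inf_ltP; exists (phi u + indicator D (x - u)%R)%E; first by exists u.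
by rewrite /indicator asboolT// adde0.
Qed.

Lemma infconv_le x u : D (x - u) -> (F x <= phi u)%E.
Proof.
move=> Du; apply: ereal_inf_lbound; exists u => //.
by rewrite /indicator asboolT// adde0.
Qed.

Lemma le_infconv x a :
  (forall u, D (x - u) -> (a <= phi u)%E) -> (a <= F x)%E.
Proof.
move=> ha; apply: le_ereal_inf_tmp => _ [u _ <-]; rewrite /indicator.
case: asboolP => Du; first by rewrite adde0 ha.
by rewrite addey ?leey// gt_eqF.
Qed.

Lemma infconv_shift d x : D d -> F (x + d) = F x.
Proof.
suff le c z : D c -> (F (z + c)%R <= F z)%E.
  move=> Dd; apply: le_anti; rewrite le//= -[X in (F X <= _)%E](addrK d) le//.
  by rewrite -scaleN1r; exact: DZ.
move=> Dc; apply: le_infconv => u Du; apply: infconv_le.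
by rewrite addrAC; exact: DD.
Qed.

Lemma hull_shift d x : D d -> g (x + d) = g x.
Proof. by move=> Dd; apply: lsc_hull_shift => z; exact: infconv_shift. Qed.

Lemma infconv_minorant x z b :
  orthocomp D z -> conjugate phi z = b%:E -> ((inner x z - b)%:E <= F x)%E.
Proof.
move=> zD zb; apply: le_infconv => u Du.
apply: le_trans (conjugate_minorant u phi_proper zb); rewrite lee_fin.
have := zD _ Du; rewrite (innerC z) innerDl innerNl; lra.
Qed.

Lemma hull_minorant x z b :
  orthocomp D z -> conjugate phi z = b%:E -> ((inner x z - b)%:E <= g x)%E.
Proof.
move=> zD zb; apply: (lsc_hull_max _ (@affine_lsc _ _ z (- b))) => x'.
exact: infconv_minorant.
Qed.

Let conj_w : conjugate phi w = (fine (conjugate phi w))%:E.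
Proof. by rewrite fineK// fin_numElt w_dom andbT conjugate_gtNy. Qed.

Lemma hull_proper : proper_fun g.
Proof.
split=> [x|]; first exact: lt_le_trans (ltNyr _) (hull_minorant x wD conj_w).
have [_ [x xfin]] := phi_proper; exists x.
apply: le_lt_trans xfin; apply: le_trans (lsc_hull_le _ _) _.
by apply: infconv_le; rewrite subrr.
Qed.

(** A convex combination of points of two translates of [D] lies in the
    translate of the convex combination, so the strict epigraph of the infimal
    convolution inherits convexity. *)
Lemma hull_resolvent gamma y :
  0 < gamma -> exists p, subdiff g p (gamma^-1 *: (y - p)).
Proof.
move=> g0; apply: (@lsc_hull_resolvent _ _ _ w (- fine (conjugate phi w))) => //.
- move=> x r x' r' t t01 /infconv_ltP[u Du ur] /infconv_ltP[u' Du' ur'].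
  apply/infconv_ltP; exists (t *: u + (1 - t) *: u'); last exact: phi_convex.
  rewrite opprD addrACA -!scalerBr; apply: DP => //; exact: DZ.
- have [_ [x xfin]] := phi_proper; exists x; apply: le_lt_trans xfin.
  by apply: infconv_le; rewrite subrr.
- by move=> x; exact: infconv_minorant.
Qed.

Lemma subdiff_hull_shift d x u : D d -> subdiff g x u -> subdiff g (x + d) u.
Proof.
move=> Dd xu y; rewrite hull_shift//.
rewrite -(@hull_shift (- d) y); last by rewrite -scaleN1r; exact: DZ.
by have := xu (y - d); rewrite opprD addrA addrAC.
Qed.

(** Along [D] the function [g] is constant, so a subgradient has no component
    in that direction. *)
Lemma subdiff_hull_orthocomp x u : subdiff g x u -> orthocomp D u.
Proof.
move=> xu; have gx := subdiff_fin_num hull_proper xu.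
have le0 d : D d -> inner u d <= 0.
  move=> Dd; have := xu (x + d); rewrite hull_shift//.
  by rewrite -{2}[g x]add0e leeD2rE// lee_fin addrAC subrr add0r innerC.
move=> d Dd; apply: le_anti; rewrite le0//= -oppr_le0 -innerNr le0//.
by rewrite -scaleN1r; exact: DZ.
Qed.

Let h z := (conjugate phi z + conjugate (indicator D) z)%E.

Let hE z : h z = (conjugate phi z + indicator (orthocomp D) z)%E.
Proof. by rewrite /h conjugate_indicator. Qed.

(** The sum of extended reals is -oo as soon as one term is, which is why the
    first conjugate has to be known to avoid -oo. *)
Lemma dom_conjugate_sum z : (h z < +oo)%E -> orthocomp D z.
Proof.
rewrite hE /indicator; case: asboolP => // _.
by rewrite addey// gt_eqF// conjugate_gtNy.
Qed.

Lemma conjugate_sum_proper : proper_fun h.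
Proof.
split=> [z|]; last first.
  by exists w; rewrite /dom/= hE /indicator asboolT// adde0.
rewrite hE /indicator; case: asboolP => _.
  by rewrite adde0 conjugate_gtNy.
by rewrite addey// gt_eqF// conjugate_gtNy.
Qed.

(** The sum of the conjugates is the conjugate of [g], and a subgradient [u] at
    [x] gives equality in the Fenchel-Young inequality. At [u]
    this equality comes from the subgradient inequality on [phi]; the affine
    minorants of [g] give the Fenchel-Young inequality everywhere else. *)
Lemma subdiff_conjugate_sum x u : subdiff g x u -> subdiff h u x.
Proof.
move=> xu z.
have gx := subdiff_fin_num hull_proper xu.
have uD := subdiff_hull_orthocomp xu.
have hu : (h u <= (inner x u - fine (g x))%:E)%E.
  rewrite hE /indicator asboolT// adde0; apply: ge_ereal_sup => _ [v _ <-].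
  have : ((inner (v - x) u)%:E + g x <= phi v)%E.
    apply: le_trans (xu v) _; apply: le_trans (lsc_hull_le _ _) _.
    by apply: infconv_le; rewrite subrr.
  rewrite -(fineK gx) -EFinD; have := phiN v.
  case: (phi v) => [r| |]//; last by rewrite leNye.
  by rewrite -EFinB !lee_fin innerDl innerNl; lra.
apply: le_trans (leeD2l _ hu) _; rewrite -EFinD.
have [hz|] := ltP (h z) +oo%E; last by rewrite leye_eq => /eqP ->; rewrite leey.
have zD := dom_conjugate_sum hz.
have hzE : h z = conjugate phi z by rewrite hE /indicator asboolT// adde0.
have cz : conjugate phi z \is a fin_num.
  by rewrite fin_numElt conjugate_gtNy//= -hzE.
rewrite hzE -(fineK cz) lee_fin.
have := hull_minorant x zD (esym (fineK cz)).
rewrite -(fineK gx) lee_fin innerDl innerNl (innerC z) (innerC u) /=; lra.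
Qed.

End infconv_subspace.

(** * The cyclic shift *)

Section orthogonal_complement.
Context (R : realType) (E : hilbertType R) (D : set E).
Implicit Types (x y : E).

Lemma orthocomp_linear (a : R) x y :
  orthocomp D x -> orthocomp D y -> orthocomp D (a *: x + y).
Proof. by move=> xD yD d Dd; rewrite !innerE xD// yD// mulr0 addr0. Qed.

Lemma orthocomp0 : orthocomp D 0.
Proof. by move=> d _; rewrite inner0l. Qed.

Lemma orthocompZ (a : R) x : orthocomp D x -> orthocomp D (a *: x).
Proof. by move=> xD d Dd; rewrite !innerE xD// mulr0. Qed.

Lemma orthocompD x y : orthocomp D x -> orthocomp D y -> orthocomp D (x + y).
Proof. by move=> xD yD d Dd; rewrite !innerE xD// yD// addr0. Qed.

Lemma orthocompB x y : orthocomp D x -> orthocomp D y -> orthocomp D (x - y).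
Proof. by move=> xD yD d Dd; rewrite !innerE xD// yD// subr0. Qed.

Lemma orthocomp_closed : closed (orthocomp D).
Proof.
have -> : orthocomp D = \bigcap_(d in D) [set x | inner x d = 0].
  by apply/seteqP; split=> x hx d /hx.
apply: closed_bigI => d _.
apply: (@preimage_closed _ _ (fun x : E => inner x d) [set r | r = 0]).
  by move=> x _; apply: inner_cvgl; exact: cvg_id.
exact: closed_eq.
Qed.

End orthogonal_complement.

Section cyclic_shift.
Context (R : realType) (m : nat) (X : hilbertType R).
Local Notation XX := (hilbert_pow m X).
Local Notation D := (Delta m X).
Local Notation shift := (@cshift R m X).
Implicit Types (x y d : XX).

Lemma cshift0 : cshift (0 : XX) = 0.
Proof. by apply/ffunP => i; rewrite !ffunE. Qed.

Lemma cshiftD x y : cshift (x + y) = cshift x + cshift y.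
Proof. by apply/ffunP => i; rewrite !ffunE. Qed.

Lemma cshiftB x y : cshift (x - y) = cshift x - cshift y.
Proof. by apply/ffunP => i; rewrite !ffunE. Qed.

Lemma cshift_isometry x y : inner (cshift x) (cshift y) = inner x y.
Proof.
rewrite !inner_powE [RHS](reindex (@ord_pred m))/=; last first.
  by apply: onW_bij; exact: ord_pred_bij.
by apply: eq_bigr => i _; rewrite !ffunE.
Qed.

Lemma norm_cshift x : `|cshift x| = `|x|.
Proof. by rewrite !normE_inner cshift_isometry. Qed.

Lemma cshift_Delta d : D d -> cshift d = d.
Proof. by move=> [z _ <-]; apply/ffunP => i; rewrite !ffunE. Qed.

Lemma Delta0 : D 0.
Proof. by exists 0 => //; apply/ffunP => i; rewrite !ffunE. Qed.

Lemma Delta_linear (a : R) x y : D x -> D y -> D (a *: x + y).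
Proof.
move=> [z _ <-] [z' _ <-]; exists (a *: z + z') => //.
by apply/ffunP => i; rewrite !ffunE.
Qed.

Lemma iter_cshiftE k x i : iter k shift x i = x (iter k (@ord_pred m) i).
Proof. by elim: k i => //= k IH i; rewrite ffunE IH -iterSr. Qed.

Lemma val_iter_ord_pred k (i : 'I_m) :
  (k <= m)%N -> val (iter k (@ord_pred m) i) = ((i + (m - k)) %% m)%N.
Proof.
elim: k => [_|k IH km] /=; first by rewrite subn0 modnDr modn_small.
rewrite IH ?(ltnW km)//.
have m0 : (0 < m)%N by exact: leq_ltn_trans km.
have -> : (((i + (m - k)) %% m + m).-1 = (i + (m - k)) %% m + m.-1)%N.
  by rewrite -subn1 -addnBA// subn1.
rewrite modnDml; apply/eqP.
rewrite -(eqn_modDr 1) -addnA addn1 prednK// modnDr -addnA addn1.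
by rewrite -subSn// subSS.
Qed.

Lemma iter_cshift_m x : iter m shift x = x.
Proof.
apply/ffunP => i; rewrite iter_cshiftE; congr (x _); apply/val_inj.
by rewrite val_iter_ord_pred// subnn addn0 modn_small.
Qed.

Lemma iter_cshift_isometry k x y :
  inner (iter k shift x) (iter k shift y) = inner x y.
Proof. by elim: k => //= k IH; rewrite cshift_isometry. Qed.

Lemma iter_cshift_Delta k d : D d -> iter k shift d = d.
Proof. by move=> Dd; elim: k => //= k ->; exact: cshift_Delta. Qed.

Lemma iter_cshiftB k x y :
  iter k shift (x - y) = iter k shift x - iter k shift y.
Proof. by elim: k => //= k ->; rewrite cshiftB. Qed.

Lemma norm_iter_cshift k x : `|iter k shift x| = `|x|.
Proof. by rewrite !normE_inner iter_cshift_isometry. Qed.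

Lemma cshift_orthocomp x : orthocomp D x -> orthocomp D (cshift x).
Proof.
by move=> xD d Dd; rewrite -(cshift_Delta Dd) cshift_isometry xD.
Qed.

Lemma fixed_cshift_Delta (m_gt0 : (0 < m)%N) x : cshift x = x -> D x.
Proof.
move=> xfix; exists (x (Ordinal m_gt0)) => //.
have x_iter k i : x (iter k (@ord_pred m) i) = x i.
  rewrite -iter_cshiftE; congr (fun_of_fin _ i).
  by elim: k => //= k ->.
apply/ffunP => i; rewrite ffunE -(x_iter i i); congr (x _).
apply/val_inj; rewrite val_iter_ord_pred ?(ltnW (ltn_ord i))//=.
by rewrite subnKC ?modnn// ltnW.
Qed.

Let W y : XX := 2^-1 *: y + skewT y.

(** The term Id / 2 is the missing term k = 0 of the sum that defines T. *)
Lemma skewT_weights (m_gt0 : (0 < m)%N) y :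
  W y = (2 * m%:R)^-1 *:
    \sum_(0 <= k < m) (m%:R - 2 * k%:R) *: iter k shift y.
Proof.
rewrite big_ltn//= scalerDr mulr0 subr0 scalerA /W /skewT; congr (_ *: _ + _).
by field; rewrite pnatr_eq0 -lt0n.
Qed.

(** Summation by parts: the weights m - 2 k drop by 2 at each step, and the
    boundary term at k = m returns to [x] because the shift has order m. *)
Lemma skewT_telescope (m_gt0 : (0 < m)%N) x :
  W (x - cshift x) = x - m%:R^-1 *: \sum_(0 <= k < m) iter k shift x.
Proof.
have m0 : m%:R != 0 :> R by rewrite pnatr_eq0 -lt0n.
rewrite skewT_weights//.
have tele n : \sum_(0 <= k < n) (m%:R - 2 * k%:R) *: iter k shift (x - cshift x)
    = (m%:R + 2) *: x - 2 *: (\sum_(0 <= k < n) iter k shift x)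
      - (m%:R - 2 * n%:R + 2) *: iter n shift x.
  elim: n => [|n IH].
    by rewrite !big_geq//; apply: inner_ext => z; rewrite !innerE inner0l; ring.
  rewrite !big_nat_recr//= IH iter_cshiftB -iterSr -natr1.
  by apply: inner_ext => z; rewrite !innerE; ring.
rewrite tele iter_cshift_m; apply: inner_ext => z.
by rewrite !innerE; field.
Qed.

Lemma orbit_sum_Delta (m_gt0 : (0 < m)%N) x :
  D (\sum_(0 <= k < m) iter k shift x).
Proof.
apply: fixed_cshift_Delta => //.
have -> : cshift (\sum_(0 <= k < m) iter k shift x) =
    \sum_(0 <= k < m) iter k.+1 shift x.
  exact: (big_morph _ cshiftD cshift0).
apply/eqP; rewrite -subr_eq0 -sumrB telescope_sumr// iter_cshift_m subrr//.
Qed.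

(** The mean over the orbit is the orthogonal projection onto the diagonal:
    against a fixed vector of the isometry, all iterates have the same inner
    product. *)
Lemma orbit_mean_orthocomp (m_gt0 : (0 < m)%N) x :
  orthocomp D (x - m%:R^-1 *: \sum_(0 <= k < m) iter k shift x).
Proof.
move=> d Dd; rewrite !innerE.
have -> : inner (\sum_(0 <= k < m) iter k shift x) d =
    \sum_(0 <= k < m) inner x d.
  rewrite inner_suml.
  by apply: eq_bigr => k _; rewrite -{1}(iter_cshift_Delta k Dd)
    iter_cshift_isometry.
rewrite sumr_const_nat subn0 -(mulr_natl (inner x d)) mulrA mulVf ?mul1r ?subrr//.
by rewrite pnatr_eq0 -lt0n.
Qed.

(** The sum over the orbit of [x] is invariant under the shift, hence diagonal;
    for [x] orthogonal to the diagonal it is orthogonal to itself. *)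
Lemma skewT_left_inverse (m_gt0 : (0 < m)%N) x :
  orthocomp D x -> W (x - cshift x) = x.
Proof.
move=> xD; rewrite skewT_telescope//.
set s := \sum_(0 <= _ < _) _.
suff -> : s = 0 by rewrite scaler0 subr0.
have sD : D s by exact: orbit_sum_Delta.
apply: inner_eq0; have := orbit_mean_orthocomp m_gt0 x sD.
rewrite innerDl xD// innerNl innerZl add0r => /eqP.
by rewrite oppr_eq0 mulf_eq0 invr_eq0 pnatr_eq0 gtn_eqF//= => /eqP ->.
Qed.

(** The adjoint of the k-th power of the shift is the (m - k)-th power, and the
    weights m - 2 k change sign under k |-> m - k. *)
Lemma skewT_skew y : inner (skewT y) y = 0.
Proof.
rewrite innerZl inner_suml.
set S := \sum_(1 <= _ < _) _.
suff h : S = - S by rewrite (_ : S = 0) ?mulr0//; lra.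
rewrite {1}/S big_nat_rev/= -sumrN; apply: eq_big_nat => k /andP[k0 km].
rewrite add1n subSS !innerZl natrB ?(ltnW km)//.
have -> : inner (iter (m - k) shift y) y = inner (iter k shift y) y.
  rewrite -(iter_cshift_isometry k) -iterD subnKC ?(ltnW km)//.
  by rewrite iter_cshift_m innerC.
by ring.
Qed.

Lemma skewTB x y : skewT (x - y) = skewT x - skewT y.
Proof.
rewrite /skewT -scalerBr -sumrB; congr (_ *: _).
by apply: eq_bigr => k _; rewrite iter_cshiftB scalerBr.
Qed.

(** The left inverse Id / 2 + T of Id - R is a finite combination of
    isometries, hence bounded. *)
Lemma norm_le_cshift (m_gt0 : (0 < m)%N) : exists2 K : R, 0 < K &
  forall x, orthocomp D x -> `|x| <= K * `|x - cshift x|.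
Proof.
pose K : R := 1 + `|(2 * m%:R)^-1| * \sum_(1 <= k < m) `|m%:R - 2 * k%:R|.
exists K => [|x xD].
  by rewrite ltr_pwDl// mulr_ge0// sumr_ge0.
rewrite -{1}(skewT_left_inverse m_gt0 xD) (le_trans (ler_normD _ _))//.
rewrite /K mulrDl lerD//.
  by rewrite normrZ ler_wpM2r// ger0_norm ?invr_ge0// invf_le1// ler1n.
rewrite /skewT normrZ -mulrA ler_wpM2l// mulr_suml.
apply: le_trans (ler_norm_sum _ _ _) _; apply: ler_sum => k _.
by rewrite normrZ norm_iter_cshift.
Qed.

End cyclic_shift.

(** * Separable sums *)

Section separable_sum.
Context (R : realType) (m : nat) (X : hilbertType R).
Context (f : 'I_m -> X -> \bar R)
  (f_proper : forall i, proper_fun (f i))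
  (f_convex : forall i, convex_efun (f i)).
Implicit Types u v : hilbert_pow m X.

Let fN i z : (-oo < f i z)%E. Proof. by case: (f_proper i). Qed.

Lemma sepsum_fin_num u i : (sepsum f u < +oo)%E -> f i (u i) \is a fin_num.
Proof.
move=> fu; rewrite fin_numElt fN/= ltey; apply/eqP => fiy.
move: fu; rewrite ltey => /eqP; apply; apply/esum_eqyP => [j _|].
  by rewrite gt_eqF.
by exists i; rewrite mem_index_enum.
Qed.

Lemma sepsum_fineE u : (sepsum f u < +oo)%E ->
  sepsum f u = (\sum_(i < m) fine (f i (u i)))%:E.
Proof.
move=> fu; rewrite -sumEFin; apply: eq_bigr => i _.
by rewrite fineK// sepsum_fin_num.
Qed.

Lemma sepsum_proper : proper_fun (sepsum f).
Proof.
split=> [u|].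
  rewrite ltNye; apply/eqP => /esum_eqNyP[i [_ _ fi]].
  by have := fN i (u i); rewrite fi.
have /choice[z zfin] : forall i, exists z, (f i z < +oo)%E.
  by move=> i; case: (f_proper i).
exists [ffun i => z i]; apply: lte_sum_pinfty => i _; rewrite ffunE; exact: zfin.
Qed.

Lemma sepsum_convex u r u' r' (t : R) : 0 < t < 1 ->
  (sepsum f u < r%:E)%E -> (sepsum f u' < r'%:E)%E ->
  (sepsum f (t *: u + (1 - t) *: u')%R < (t * r + (1 - t) * r')%:E)%E.
Proof.
move=> t01 fu fu'.
have fuy := lt_trans fu (ltry _); have fuy' := lt_trans fu' (ltry _).
move: fu fu'; rewrite sepsum_fineE// sepsum_fineE// !lte_fin => fu fu'.
apply: (@le_lt_trans _ _ (t * (\sum_(i < m) fine (f i (u i))) +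
   (1 - t) * (\sum_(i < m) fine (f i (u' i))))%:E).
  rewrite !mulr_sumr -big_split -sumEFin; apply: lee_sum => i _.
  rewrite !ffunE; apply: le_trans (f_convex _ _ _ t01) _.
  rewrite -{1}(fineK (sepsum_fin_num i fuy)) -{1}(fineK (sepsum_fin_num i fuy')).
  by rewrite -!EFinM -EFinD.
case/andP: t01 => t0 t1.
by rewrite lte_fin ltrD// ltr_pM2l// subr_gt0.
Qed.

End separable_sum.

(** * Relaxed iterations *)

Section relaxed_step.
Context (R : realType) (E : hilbertType R).
Implicit Types (a b s : E) (gamma lambda : R).

(** Here [a] is a difference of two points, [b] its image under an isometry and
    [s] the difference of the images of the two points under a firmly
    nonexpansive map applied to the averaged points; firmness is the hypothesis
    on [s]. The norm drops by what strict convexity of the squared norm takes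
    off the average of [a] and [b]. *)
Lemma firm_step_le gamma a b s :
  `|b| = `|a| ->
  0 <= inner s ((1 - gamma) *: a + gamma *: b - s) ->
  `|s| ^+ 2 <= `|a| ^+ 2 - gamma * (1 - gamma) * `|a - b| ^+ 2.
Proof.
move=> ba; have := sqr_ge0 `|(1 - gamma) *: a + gamma *: b - s|.
have : inner b b = inner a a by rewrite !inner_self ba.
rewrite -!inner_self !innerE (innerC b a) (innerC s a) (innerC s b).
by move=> -> ? ?; nra.
Qed.

(** With the same reading of [a], [b] and [s]: the composition is averaged with
    constant 1 / (2 - gamma), which allows relaxation parameters up to
    2 - gamma. The right-hand side exceeds the left-hand one by [lambda] times
    the sum of twice the firmness inequality and gamma |b - s|^2. *)
Lemma relaxed_step_le gamma lambda a b s :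
  `|b| = `|a| -> 0 <= gamma -> 0 <= lambda ->
  0 <= inner s ((1 - gamma) *: a + gamma *: b - s) ->
  `|a + lambda *: (s - a)| ^+ 2 <=
    `|a| ^+ 2 - lambda * (2 - gamma - lambda) * `|a - s| ^+ 2.
Proof.
move=> ba g0 l0 firm.
have h : 0 <= gamma * `|b - s| ^+ 2 by rewrite mulr_ge0// sqr_ge0.
have : 0 <= lambda * (2 * inner s ((1 - gamma) *: a + gamma *: b - s) +
   gamma * `|b - s| ^+ 2) by rewrite mulr_ge0// addr_ge0// mulr_ge0.
have : inner b b = inner a a by rewrite !inner_self ba.
rewrite -!inner_self !innerE (innerC s a) (innerC b s).
by move=> -> ?; rewrite -subr_ge0; lra.
Qed.

End relaxed_step.

Lemma invariant_contraction_fixed_point (R : realType)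
    (E : completeNormedModType R) (U : set E) (S : E -> E) (q : R) :
  closed U -> U !=set0 -> (forall x, U x -> U (S x)) -> 0 <= q < 1 ->
  (forall x y, U x -> U y -> `|S x - S y| <= q * `|x - y|) ->
  exists2 p, U p & S p = p.
Proof.
move=> Ucl U0 US /andP[q0 q1] Sq.
have [|//|//|p Up Sp] := @banach_fixed_point R E U (mkfun_fun US).
  by exists (NngNum q0); split => // -[x y] [/= Ux Uy]; exact: Sq.
by exists p => //; rewrite {2}Sp.
Qed.

(** The total decrease is at most [a 0], while as long as [a] stays above [e]
    it is at least c e times the partial sums of [t]. *)
Lemma cvg0_of_divergent_decrease (R : realType) (a t : nat -> R) (c : R) :
  0 < c -> (forall n, 0 <= a n) -> (forall n, 0 <= t n) ->
  (forall n, a n.+1 <= a n - c * t n * a n) ->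
  (\sum_(0 <= n <oo) (t n)%:E = +oo)%E ->
  a n @[n --> \oo] --> 0.
Proof.
move=> c0 a0 t0 step div.
have mono n k : a (n + k)%N <= a n.
  elim: k => [|k IH]; first by rewrite addn0.
  rewrite addnS (le_trans (step _))// (le_trans _ IH)// gerBl.
  by rewrite !mulr_ge0// ltW.
have summed n : c * a n * (\sum_(0 <= k < n) t k) <= a 0%N - a n.
  elim: n => [|n IH]; first by rewrite big_geq// mulr0 subrr.
  have s0 : 0 <= \sum_(0 <= k < n) t k by apply: sumr_ge0.
  have an1 : a n.+1 <= a n by rewrite -addn1.
  have h1 : c * a n.+1 * (\sum_(0 <= k < n) t k) <= a 0%N - a n.
    apply: le_trans IH; rewrite ler_wpM2r// ler_wpM2l// ltW//.
  have h2 : c * a n.+1 * t n <= c * t n * a n.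
    by rewrite mulrAC ler_wpM2l// mulr_ge0// ltW.
  by rewrite big_nat_recr//= mulrDr; have := step n; lra.
have unbounded M : exists n, M < \sum_(0 <= k < n) t k.
  apply: contrapT => /forallNP bounded.
  have : (\sum_(0 <= n <oo) (t n)%:E <= M%:E)%E.
    apply: lime_le; first by apply: is_cvg_nneseries => n _ _; rewrite lee_fin.
    by apply: nearW => n; rewrite sumEFin lee_fin leNgt; apply/negP/bounded.
  by rewrite div leye_eq.
apply/cvgrPdist_lt => e e0.
have [N Nlt] := unbounded (a 0%N / (c * e)).
have aN : a N < e.
  rewrite ltNge; apply/negP => ea.
  have s0 : 0 <= \sum_(0 <= k < N) t k by apply: sumr_ge0.
  have := summed N.
  move: Nlt; rewrite ltr_pdivrMr ?mulr_gt0// => h1 h2.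
  have : c * e * \sum_(0 <= k < N) t k <= c * a N * \sum_(0 <= k < N) t k.
    by rewrite ler_wpM2r// ler_wpM2l// ltW.
  by have := a0 N; lra.
exists N => // n /= Nn; rewrite sub0r normrN ger0_norm//.
by apply: le_lt_trans aN; rewrite -(subnKC Nn).
Qed.

(** * Projection onto the complement of the diagonal *)

Section projection.
Context (R : realType) (m : nat) (X : hilbertType R) (m_gt0 : (0 < m)%N).
Local Notation D := (Delta m X).
Local Notation P := (orthoproj (orthocomp D)).
Implicit Types x p : hilbert_pow m X.

Lemma orthoproj_Delta_unique x p : orthocomp D p -> D (x - p) -> P x = p.
Proof.
move=> pD xpD; apply: xget_unique.
  by split=> // v vD; rewrite innerC vD.
move=> q [qD xqD]; apply/eqP; rewrite -subr_eq0; apply/eqP/inner_eq0.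
have qpD : orthocomp D (q - p) by exact: orthocompB.
have -> : inner (q - p) (q - p) = inner (q - p) (x - p) - inner (x - q) (q - p).
  by rewrite !innerE (innerC p q) (innerC x q) (innerC x p); ring.
by rewrite qpD// xqD// subrr.
Qed.

Lemma orthoproj_Delta x : orthocomp D (P x) /\ D (x - P x).
Proof.
have pD := orbit_mean_orthocomp m_gt0 x.
have sD := orbit_sum_Delta m_gt0 x.
set p := x - _ in pD.
have xpD : D (x - p).
  rewrite opprB addrC subrK -[X in D X]addr0.
  by apply: Delta_linear => //; exact: Delta0.
by rewrite (orthoproj_Delta_unique pD xpD).
Qed.

End projection.

(** * The forward-backward step *)

Section forward_backward.
Context (R : realType) (m : nat) (X : hilbertType R) (m_gt0 : (0 < m)%N).
Local Notation XX := (hilbert_pow m X).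
Local Notation D := (Delta m X).
Context (g : XX -> \bar R) (g_proper : proper_fun g)
  (g_resolvent : forall gamma y, 0 < gamma ->
    exists p, subdiff g p (gamma^-1 *: (y - p)))
  (g_orthocomp : forall x u, subdiff g x u -> orthocomp D u)
  (gamma : R) (gamma01 : 0 < gamma < 1).
Implicit Types x z : XX.

Let g0 : 0 < gamma. Proof. by case/andP: gamma01. Qed.
Let g1 : gamma < 1. Proof. by case/andP: gamma01. Qed.

Definition fb_step z := prox gamma g ((1 - gamma) *: z + gamma *: cshift z).
Local Notation S := fb_step.

Lemma generalized_cycleE z : generalized_cycle g z <-> subdiff g z (cshift z - z).
Proof.
split=> [[u zu /eqP]|zu].
  by rewrite addr_eq0 => /eqP h; rewrite -[_ - _]opprB -h.
by exists (cshift z - z) => //; rewrite addrA subrK subrr.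
Qed.

Lemma fb_step_subdiff z :
  subdiff g (S z) (gamma^-1 *: ((1 - gamma) *: z + gamma *: cshift z - S z)).
Proof. by apply: prox_subdiff => //; exact: g_resolvent. Qed.

Lemma fb_step_firm z z' :
  0 <= inner (S z - S z') ((1 - gamma) *: (z - z') +
    gamma *: (cshift (z - z')) - (S z - S z')).
Proof.
have := subdiff_monotone g_proper (fb_step_subdiff z) (fb_step_subdiff z').
rewrite -scalerBr innerZr pmulr_rge0 ?invr_gt0// cshiftB.
by rewrite !innerE; lra.
Qed.

(** That a cycle is fixed rests on monotonicity, which leaves [z] as the only
    possible value of the proximal map at the averaged point. *)
Lemma fb_step_fixed z : S z = z <-> generalized_cycle g z.
Proof.
rewrite generalized_cycleE; split=> [Sz|zu].
  have := fb_step_subdiff z; rewrite Sz.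
  rewrite [X in subdiff _ _ X](_ : _ = cshift z - z)//.
  by apply: inner_ext => v; rewrite !innerE; field; rewrite gt_eqF.
have := subdiff_monotone g_proper zu (fb_step_subdiff z).
have -> : cshift z - z - gamma^-1 *: ((1 - gamma) *: z + gamma *: cshift z - S z)
    = - (gamma^-1 *: (z - S z)).
  by apply: inner_ext => v; rewrite !innerE; field; rewrite gt_eqF.
rewrite innerNr oppr_ge0 innerZr pmulr_rle0 ?invr_gt0// => /inner_eq0/eqP.
by rewrite subr_eq0 => /eqP/esym.
Qed.

Lemma fb_step_orthocomp z : orthocomp D z -> orthocomp D (S z).
Proof.
move=> zD; have /(orthocompZ gamma) := g_orthocomp (fb_step_subdiff z).
rewrite scalerA divff ?gt_eqF// scale1r => h.
have -> : S z = ((1 - gamma) *: z + gamma *: cshift z) -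
  ((1 - gamma) *: z + gamma *: cshift z - S z) by rewrite opprB addrC subrK.
apply: orthocompB => //; apply: orthocomp_linear => //.
by apply: orthocompZ; exact: cshift_orthocomp.
Qed.

(** A point and its image under the proximal map differ by a multiple of a
    subgradient, which is orthogonal to the diagonal. *)
Lemma fb_step_diff_orthocomp z z' :
  orthocomp D (z - z') -> orthocomp D (S z - S z').
Proof.
move=> zD.
have := orthocompB (orthocompZ gamma (g_orthocomp (fb_step_subdiff z)))
  (orthocompZ gamma (g_orthocomp (fb_step_subdiff z'))).
rewrite !scalerA divff ?gt_eqF// !scale1r => h.
have -> : S z - S z' = ((1 - gamma) *: (z - z') + gamma *: cshift (z - z')) -
  ((1 - gamma) *: z + gamma *: cshift z - S z -
   ((1 - gamma) *: z' + gamma *: cshift z' - S z')).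
  by rewrite cshiftB; apply: inner_ext => v; rewrite !innerE; ring.
apply: orthocompB => //; apply: orthocomp_linear => //.
by apply: orthocompZ; exact: cshift_orthocomp.
Qed.

(** The averaging of the isometry contracts differences orthogonal to the
    diagonal, on which |a - R a| >= |a| / K. *)
Lemma fb_step_contraction : exists2 q : R, 0 <= q < 1 &
  forall z z', orthocomp D (z - z') -> `|S z - S z'| <= q * `|z - z'|.
Proof.
have [K K0 hK] := norm_le_cshift X m_gt0.
pose eta := gamma * (1 - gamma) / K ^+ 2.
have eta0 : 0 < eta by rewrite divr_gt0 ?exprn_gt0// mulr_gt0// subr_gt0.
exists (Num.sqrt (1 - eta)) => [|z z' zD].
  by rewrite sqrtr_ge0/= -[ltRHS]sqrtr1 ltr_sqrt// ltrBlDr ltrDl.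
have := firm_step_le (norm_cshift _) (fb_step_firm z z').
set a := z - z' in zD *; set s := S z - S z' => hs.
have hK2 : `|a| ^+ 2 <= K ^+ 2 * `|a - cshift a| ^+ 2.
  by rewrite -exprMn ler_sqr ?nnegrE ?mulr_ge0 ?(ltW K0)//; exact: hK.
rewrite -[leLHS]ger0_norm// -sqrtr_sqr -[X in _ * X]ger0_norm//.
rewrite -[X in _ * X]sqrtr_sqr.
rewrite mulrC -sqrtrM ?sqr_ge0// ler_wsqrtr//.
apply: le_trans hs _; rewrite [leRHS]mulrBr mulr1 lerD2l lerN2 [leLHS]mulrC.
rewrite /eta -[leLHS]mulrA ler_wpM2l//; first by rewrite mulr_ge0// ?subr_ge0 ltW.
by rewrite ler_pdivrMl ?exprn_gt0//.
Qed.

Lemma generalized_cycle_orthocomp_exists :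
  exists2 u, orthocomp D u & generalized_cycle g u.
Proof.
have [q q01 Sq] := fb_step_contraction.
have [||||p pD Sp] :=
  @invariant_contraction_fixed_point R XX (orthocomp D) S q _ _ _ q01.
- exact: orthocomp_closed.
- by exists 0; exact: orthocomp0.
- exact: fb_step_orthocomp.
- by move=> x z xD zD; apply: Sq; exact: orthocompB.
by exists p => //; apply/fb_step_fixed.
Qed.

Lemma generalized_cycle_diff_orthocomp u v :
  generalized_cycle g u -> generalized_cycle g v -> orthocomp D (u - v) -> u = v.
Proof.
move=> /fb_step_fixed Su /fb_step_fixed Sv uvD.
have [q /andP[_ q1] Sq] := fb_step_contraction.
apply/eqP; rewrite -subr_eq0 -normr_eq0; apply: contraTT q1 => uv0.
have := Sq _ _ uvD; rewrite Su Sv -{1}[`|u - v|]mul1r -leNgt ler_pM2r//.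
by rewrite lt0r uv0 normr_ge0.
Qed.

(** The iteration keeps the difference d to the cycle orthogonal to the
    diagonal, and there the contraction property bounds the displacement
    |d - s| from below by (1 - q) |d|, s being the image of d. *)
Lemma relaxed_fb_cvg (lambda : nat -> R) (x : nat -> XX) (xt : XX) :
  (forall n, 0 < lambda n < 2 - gamma) ->
  (\sum_(0 <= n <oo) (lambda n * (2 - gamma - lambda n))%R%:E = +oo)%E ->
  (forall n, x n.+1 = x n + lambda n *: (S (x n) - x n)) ->
  generalized_cycle g xt -> orthocomp D (x 0%N - xt) ->
  (forall n, orthocomp D (x n - xt)) /\ x n @[n --> \oo] --> xt.
Proof.
move=> lambda_bnd lambda_div xS /fb_step_fixed Sxt x0D.
have [q /andP[q0 q1] Sq] := fb_step_contraction.
have xE n : x n.+1 - xt =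
    (x n - xt) + lambda n *: ((S (x n) - S xt) - (x n - xt)).
  by rewrite xS Sxt; apply: inner_ext => z; rewrite !innerE; ring.
have xD n : orthocomp D (x n - xt).
  elim: n => // n IH; rewrite xE addrC; apply: orthocomp_linear => //.
  by apply: orthocompB => //; exact: fb_step_diff_orthocomp.
split=> //.
have t0 n : 0 <= lambda n * (2 - gamma - lambda n).
  by have /andP[l0 l1] := lambda_bnd n; rewrite mulr_ge0 ?subr_ge0 ?ltW.
have c0 : 0 < (1 - q) ^+ 2 by rewrite exprn_gt0// subr_gt0.
have sq0 : `|x n - xt| ^+ 2 @[n --> \oo] --> (0 : R).
  apply: (cvg0_of_divergent_decrease c0 _ t0 _ lambda_div) => n.
    exact: sqr_ge0.
  have /andP[l0 _] := lambda_bnd n.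
  rewrite xE; apply: le_trans (relaxed_step_le (norm_cshift _) (ltW g0) (ltW l0)
    (fb_step_firm (x n) xt)) _.
  rewrite lerD2l lerN2 mulrAC mulrC ler_wpM2l// -exprMn.
  rewrite ler_sqr ?nnegrE ?mulr_ge0// ?subr_ge0 ?(ltW q1)//.
  rewrite mulrBl mul1r lerBlDr -lerBlDl (le_trans _ (Sq _ _ (xD n)))//.
  by rewrite lerBlDl (le_trans _ (ler_normD _ _))// subrK.
apply/cvgrPdist_lt => e e0.
have e20 : 0 < e ^+ 2 by rewrite exprn_gt0.
move/cvgrPdist_lt : sq0 => /(_ _ e20); apply: filterS => n.
by rewrite sub0r normrN ger0_norm ?sqr_ge0// ltr_sqr ?nnegrE ?(ltW e0)// distrC.
Qed.

End forward_backward.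

(** * Convergence to a generalized cycle *)

Theorem theorem7p2 (R : realType) (X : hilbertType R) (m : nat)
  (m_gt0 : (0 < m)%N)
  (f : 'I_m -> X -> \bar R)
  (f_Gamma0 : forall i, proper_lsc_convex (f i))
  (standing : dom (conjugate (sepsum f)) `&` orthocomp (Delta m X) !=set0)
  (gamma delta : R) (gamma01 : 0 < gamma < 1) (deltaE : delta = 2 - gamma)
  (lambda : nat -> R) (lambda_bnd : forall n, 0 < lambda n < delta)
  (lambda_div :
    (\sum_(0 <= n <oo) (lambda n * (delta - lambda n))%R%:E = +oo)%E)
  (g : hilbert_pow m X -> \bar R)
  (gE : g = lsc_hull (infconv (sepsum f) (indicator (Delta m X))))
  (x y : nat -> hilbert_pow m X)
  (yE : forall n, y n = (1 - gamma) *: x n + gamma *: cshift (x n))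
  (xS : forall n, x n.+1 = x n + lambda n *: (prox gamma g (y n) - x n)) :
  let P := orthoproj (orthocomp (Delta m X)) in
  exists xt : hilbert_pow m X,
    [/\ weakly_cvg x xt /\ generalized_cycle g xt,
        cshift (x n) - x n @[n --> \oo] --> cshift xt - xt /\
        generalized_gap_vector f = [set cshift xt - xt]
      & P (x n) @[n --> \oo] --> P xt /\
        generalized_cycle g `&` orthocomp (Delta m X) = [set P xt]].
Proof.
move=> P; subst delta; have [w [w_dom wD]] := standing.
have f_proper i : proper_fun (f i) by case: (f_Gamma0 i).
have f_convex i : convex_efun (f i) by case: (f_Gamma0 i).
have sf_proper := sepsum_proper f_proper.
have sf_convex := sepsum_convex f_proper f_convex.
have D0 := Delta0 m X.
have DP := @Delta_linear R m X.
have g_proper : proper_fun g.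
  by rewrite gE; exact: (hull_proper sf_proper D0 wD w_dom).
have g_resolvent c z : 0 < c -> exists p, subdiff g p (c^-1 *: (z - p)).
  by rewrite gE; exact: (hull_resolvent sf_proper sf_convex D0 DP wD w_dom).
have g_orth z u : subdiff g z u -> orthocomp (Delta m X) u.
  by rewrite gE; exact: (subdiff_hull_orthocomp sf_proper D0 DP wD w_dom).
have g_shift d z u : Delta m X d -> subdiff g z u -> subdiff g (z + d) u.
  by rewrite gE; exact: (subdiff_hull_shift sf_proper D0 DP).
have [u uD u_cyc] := generalized_cycle_orthocomp_exists m_gt0 g_proper
  g_resolvent g_orth gamma01.
have [_ x0D] := orthoproj_Delta m_gt0 (x 0%N).
have [Px0D _] := orthoproj_Delta m_gt0 (x 0%N).
set d := x 0%N - _ in x0D.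
(* The limit keeps the diagonal component d of the starting point. *)
pose xt := u + d.
have xtR : cshift xt - xt = cshift u - u.
  by rewrite /xt cshiftD (cshift_Delta x0D) opprD addrACA subrr addr0.
have Pxt : P xt = u.
  by apply: orthoproj_Delta_unique => //; rewrite addrC addKr.
have xt_cyc : generalized_cycle g xt.
  by apply/generalized_cycleE; rewrite xtR; apply: g_shift => //;
    exact/generalized_cycleE.
have [xD xcvg] :
    (forall n, orthocomp (Delta m X) (x n - xt)) /\ x n @[n --> \oo] --> xt.
  apply: (relaxed_fb_cvg m_gt0 g_proper g_resolvent g_orth gamma01
    lambda_bnd lambda_div) => //.
    by move=> n; rewrite xS yE.
  rewrite /xt /d opprD addrCA opprB [X in - u + X]addrCA subrr addr0 addrC.
  exact: orthocompB.
exists xt; split; split=> //.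
- by move=> v; exact: inner_cvgl.
- apply: cvgB => //.
  apply/cvgrPdist_lt => e e0; move/cvgrPdist_lt : xcvg => /(_ _ e0).
  by apply: filterS => n; rewrite -cshiftB norm_cshift.
- rewrite xtR; set h := (fun z => conjugate (sepsum f) z +
    conjugate (indicator (Delta m X)) z)%E.
  have h_proper : proper_fun h := conjugate_sum_proper sf_proper D0 DP wD w_dom.
  have gap_u : generalized_gap_vector f (cshift u - u).
    exists u; last first.
      have := skewT_left_inverse m_gt0 uD.
      rewrite !skewTB => {1}<-.
      by apply: inner_ext => z; rewrite !innerE inner0l; ring.
    move/generalized_cycleE : u_cyc; rewrite gE.
    exact: (subdiff_conjugate_sum sf_proper D0 DP wD w_dom).
  (* Monotonicity leaves - |v - v'|^2 / 2 >= 0, the skew part being invisible. *)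
  have gap_mono v v' :
      generalized_gap_vector f v -> generalized_gap_vector f v' -> v = v'.
    move=> [a av aE] [b bv bE].
    have := subdiff_monotone h_proper av bv.
    have -> : a - b = - (2^-1 *: (v - v') + skewT (v - v')).
      rewrite skewTB; apply/eqP; rewrite -addr_eq0; apply/eqP.
      rewrite -[RHS](subrr 0) -{1}aE -bE.
      by apply: inner_ext => z; rewrite !innerE; ring.
    rewrite innerNr innerDr innerZr (innerC _ (skewT _)) skewT_skew addr0.
    rewrite oppr_ge0 pmulr_rle0// => /inner_eq0/eqP.
    by rewrite subr_eq0 => /eqP.
  apply/seteqP; split=> v /=; last by move=> ->.
  by move=> hv; exact: gap_mono.
(* x n and xt have the same diagonal component. *)
- have -> : (fun n => P (x n)) = (fun n => x n - d).
    apply/funext => n; apply: orthoproj_Delta_unique; last first.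
      by rewrite opprB addrC subrK.
    have -> : x n - d = (x n - xt) + u.
      by apply: inner_ext => z; rewrite /xt !innerE; ring.
    exact: orthocompD.
  have -> : P xt = xt - d by rewrite Pxt /xt addrK.
  by apply: cvgB => //; exact: cvg_cst.
- rewrite Pxt; apply/seteqP; split=> v /=; last by move=> ->.
  move=> [v_cyc vD].
  exact: (generalized_cycle_diff_orthocomp m_gt0 g_proper g_resolvent gamma01
    v_cyc u_cyc (orthocompB vD uD)).
Qed.
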